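(* Let $k$ and $\ell$ be natural numbers. Then for all sufficiently large $n$ there are $k$ pairwise disjoint sets of $\ell$ partitions of $n$ such that all of the $\ell$ partitions in each set have the same multiset of hook numbers, and partitions belonging to distinct sets have different multisets of hook numbers and, moreover, different products of hook numbers.
   Context: Natural numbers are positive integers. A partition of $n$ is a weakly decreasing sequence of positive integers with sum $n$, drawn as a left-justified diagram of boxes whose $i$-th row (counting from the top) has $\lambda_i$ boxes. The hook number of a box is the number of boxes to its right in the same row, plus the number of boxes below it in the same column, plus $1$. *)

(* Defs.v *)
From mathcomp Require Import all_boot.
From mathcomp Require Import finmap multiset.

Set Implicit Arguments.
Unset Strict Implicit.
Unset Printing Implicit Defensive.

Definition is_partition (n : nat) (la : seq nat) : bool :=
  [&& sorted geq la, all (fun p => 0 < p) la & sumn la == n].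

(* Boxes are (row, column) pairs, both numbered from 0. *)
Definition boxes (la : seq nat) : seq (nat * nat) :=
  [seq (i, j) | i <- iota 0 (size la), j <- iota 0 (nth 0 la i)].

Definition arm (la : seq nat) (b : nat * nat) : nat :=
  count (fun c => (c.1 == b.1) && (b.2 < c.2)) (boxes la).

Definition leg (la : seq nat) (b : nat * nat) : nat :=
  count (fun c => (c.2 == b.2) && (b.1 < c.1)) (boxes la).

Definition hook (la : seq nat) (b : nat * nat) : nat := arm la b + leg la b + 1.

Definition hook_multiset (la : seq nat) : {mset nat}%mset :=
  seq_mset [seq hook la b | b <- boxes la].

Definition hook_product (la : seq nat) : nat := \prod_(b <- boxes la) hook la b.

(* Main.v *)
(* The boundary of a diagram is a word w of vertical and horizontal steps, and
   hooks are the pairs of a vertical step preceding a horizontal one. Let d(w)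
   be the alternating sum of the powers of X at the positions where the boundary
   turns; the hook multiset is determined by d(w)(X) d(w)(1/X). If the turns of
   a word are far enough apart, putting copies of u and of its complement there
   multiplies the polynomial of the word by d(u). The factors 1 - X^D + X^(3D)
   and 1 - X^(2D) + X^(3D) are mirror images of each other, so choosing between
   them l times gives 2^l words with the same hooks. A last factor with free
   parameters e and b reaches every large size n: e = r + D i, where the residue
   r is forced by n, and then b is a decreasing function of i. Since b is of the
   order of n, the product of the hooks is governed by the number e + b of
   vertical steps, which decreases when i grows; hence the products are distinct
   for i < k. *)

Require Import Defs.
From mathcomp Require Import all_boot finmap multiset.
From mathcomp Require Import ssralg ssrint poly zify ring.

Set Implicit Arguments.
Unset Strict Implicit.
Unset Printing Implicit Defensive.

Import GRing.Theory.

(** * Diagrams as boundary words *)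

(* A word lists the boundary of a diagram from its top right end: true is a
   vertical step, hence a row, and false is a horizontal step. *)
Fixpoint rows (w : seq bool) : seq nat :=
  if w is b :: v then if b then count negb v :: rows v else rows v else [::].

(* The positions of the letter false, numbered from 1. *)
Fixpoint gaps (w : seq bool) : seq nat :=
  if w is b :: v then nseq (~~ b) 1 ++ map S (gaps v) else [::].

Fixpoint hooks (w : seq bool) : seq nat :=
  if w is b :: v then (if b then gaps v else [::]) ++ hooks v else [::].

Lemma size_gaps w : size (gaps w) = count negb w.
Proof. by elim: w => //= b w IH; rewrite size_cat size_nseq size_map IH. Qed.

Lemma size_rows w : size (rows w) = count id w.
Proof. by elim: w => //= -[|] w IH /=; rewrite IH. Qed.

Lemma rows_le w : all (leq^~ (count negb w)) (rows w).
Proof.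
elim: w => //= -[|] w IH /=; first by rewrite leqnn.
by apply: sub_all IH => x; rewrite add1n; apply: leqW.
Qed.

Lemma rows_sorted w : sorted geq (rows w).
Proof.
elim: w => //= -[|] w IH //=; rewrite path_sortedE; first by rewrite rows_le.
by move=> y x z /= yx zy; apply: leq_trans yx.
Qed.

Lemma rows_gt0 w : all (fun p => 0 < p) (rows (rcons w false)).
Proof.
by elim: w => //= -[|] w IH //=; rewrite IH -cats1 count_cat /= addn1.
Qed.

Lemma rows_inj w w' : size w = size w' -> rows w = rows w' -> w = w'.
Proof.
elim: w w' => [|b w IH] [|b' w'] //= [sz].
(* At equal sizes, one more vertical step in [y] means one horizontal step fewer, so no row of [y]
   can have length [count negb x]. *)
have rows_neq (x y : seq bool) : size x = size y -> count negb x :: rows x <> rows y.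
  move=> sxy e; have := size_rows y; rewrite -e /= size_rows.
  have := rows_le y; rewrite -e /= => /andP[le _].
  have := count_predC id x; have := count_predC id y.
  rewrite /predC; have E v : count (fun z => ~~ id z) v = count negb v by [].
  rewrite !E; lia.
case: b b' => [] [] /= e.
- by case: e => _ /(IH _ sz) ->.
- by case: (rows_neq w w').
- by case: (rows_neq w' w).
- by rewrite (IH _ sz e).
Qed.

(** The product is the rectangle where rows of [x] meet columns of [y]. *)
Lemma sumn_rows_cat x y :
  sumn (rows (x ++ y)) = sumn (rows x) + sumn (rows y) + count id x * count negb y.
Proof.
elim: x => [|[|] x IH] /=; first by rewrite mul0n addn0.
  by rewrite count_cat IH; lia.
by rewrite IH.
Qed.

Lemma sumn_rows_nseq b n : sumn (rows (nseq n b)) = 0.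
Proof. by case: b; elim: n => //= n ->; rewrite count_nseq. Qed.

Lemma count_id_map_negb w : count id (map negb w) = count negb w.
Proof. by rewrite count_map; apply: eq_count. Qed.

Lemma count_negb_map_negb w : count negb (map negb w) = count id w.
Proof. by rewrite count_map; apply: eq_count => -[]. Qed.

Lemma count_id_negb w : count id w + count negb w = size w.
Proof. by rewrite -(count_predC id w); congr addn. Qed.

(** Each pair of a vertical and a horizontal step of [w] is a box of exactly one of the two
    diagrams, according to which step comes first. *)
Lemma sumn_rows_map_negb w :
  sumn (rows w) + sumn (rows (map negb w)) = count id w * count negb w.
Proof.
by elim: w => //= -[|] w IH /=; rewrite ?count_negb_map_negb; lia.
Qed.

(** * Hook numbers as distances along the boundary *)

Lemma boxes_cons c la :
  boxes (c :: la) =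
  [seq (0, j) | j <- iota 0 c] ++ [seq (b.1.+1, b.2) | b <- boxes la].
Proof.
rewrite /boxes /=; congr cat.
rewrite (iotaDl 1 0 (size la)) -map_comp map_flatten -map_comp; congr flatten.
by apply: eq_map => i /=; rewrite -map_comp.
Qed.

Lemma arm_head c la j : j < c -> arm (c :: la) (0, j) = c - j.+1.
Proof.
move=> jc; rewrite /arm boxes_cons count_cat !count_map /=.
rewrite [X in _ + X](_ : _ = 0) ?addn0; last first.
  by apply/eqP; rewrite -leqn0 leqNgt -has_count; apply/hasPn.
have -> : iota 0 c = iota 0 j.+1 ++ iota j.+1 (c - j.+1) by rewrite -iotaD subnKC.
rewrite count_cat (eq_in_count (a2 := pred0)) => [|x]; last first.
  by rewrite mem_iota /= ltnS leqNgt => /negbTE.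
rewrite count_pred0 (eq_in_count (a2 := predT)) => [|x]; last first.
  by rewrite mem_iota /= => /andP[].
by rewrite count_predT size_iota.
Qed.

Lemma count_boxes_col la j : count (fun c => c.2 == j) (boxes la) = count (ltn j) la.
Proof.
elim: la => //= c la IH; rewrite boxes_cons count_cat !count_map /=; congr addn => //.
by rewrite (eq_count (a2 := pred1 j)) // count_uniq_mem ?iota_uniq // mem_iota add0n.
Qed.

Lemma leg_head c la j : leg (c :: la) (0, j) = count (ltn j) la.
Proof.
rewrite /leg boxes_cons count_cat !count_map /=.
rewrite [X in X + _](_ : _ = 0) ?add0n; last first.
  by apply/eqP; rewrite -leqn0 leqNgt -has_count; apply/hasPn => x _ /=; rewrite andbF.
by rewrite -count_boxes_col; apply: eq_count => b /=; rewrite andbT.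
Qed.

Lemma hook_tail c la b : hook (c :: la) (b.1.+1, b.2) = hook la b.
Proof.
rewrite /hook /arm /leg boxes_cons !count_cat !count_map /=.
have count0 (p : pred nat) n : (forall x, p x = false) -> count p (iota 0 n) = 0.
  by move=> p0; rewrite (eq_count p0) count_pred0.
by rewrite !count0 // => x; rewrite /= ltn0 andbF.
Qed.

(** For the row of a vertical step put before [w], the arm and the leg of a box count the horizontal
    and vertical steps strictly between the ends of its hook, so the hook number is the distance of
    these ends. Columns are numbered from the left but [w] is read from the right, hence a
    permutation. *)
Lemma perm_first_row w :
  perm_eq [seq (count negb w - j.+1) + count (ltn j) (rows w) + 1
            | j <- iota 0 (count negb w)] (gaps w).
Proof.
elim: w => // -[|] w IH.
  apply: (perm_trans _ (perm_map S IH)) => /=; rewrite add0n.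
  rewrite -map_comp; apply/permP => p; congr count; apply/eq_in_map => j.
  by rewrite mem_iota /= => ->; lia.
have -> : count negb (false :: w) = count negb w + 1 by rewrite /= addnC.
rewrite iotaD map_cat perm_catC add0n /=.
have -> : count (ltn (count negb w)) (rows w) = 0.
  apply/eqP; rewrite -leqn0 leqNgt -has_count; apply/hasPn => x /(allP (rows_le w)).
  by rewrite /= -leqNgt.
rewrite !addn1 subnn /= perm_cons; apply: (perm_trans _ (perm_map S IH)).
rewrite -map_comp; apply/permP => p; congr count.
by apply/eq_in_map => j; rewrite mem_iota /=; lia.
Qed.

Lemma perm_hooks w : perm_eq [seq hook (rows w) b | b <- boxes (rows w)] (hooks w).
Proof.
elim: w => //= -[|] w IH //=.
rewrite boxes_cons map_cat perm_cat //.
  apply: perm_trans (perm_first_row w).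
  rewrite -map_comp; apply/permP => p; congr count; apply/eq_in_map => j.
  by rewrite mem_iota /= => jc; rewrite /hook arm_head // leg_head.
by rewrite -map_comp (eq_map (hook_tail _ _)).
Qed.

(** * Corner polynomials *)

Section CornerPolynomial.

Local Open Scope ring_scope.

Implicit Types (w x y u v : seq bool).

Fixpoint false_poly w : {poly int} :=
  if w is b :: v then (~~ b)%:R + 'X * false_poly v else 0.

Fixpoint true_poly_rev w : {poly int} :=
  if w is b :: v then b%:R * 'X^(size v) + true_poly_rev v else 0.

(** The factor ['X - 1] telescopes each run of horizontal steps, leaving signed powers at the turns;
    [w] counts as preceded by horizontal and followed by vertical steps. *)
Definition corners w : {poly int} := 1 + ('X - 1) * false_poly w.

(** This is ['X^(size w)] times the value of [corners w] at 1/X, written without negative powers. *)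
Definition corners_rev w : {poly int} := 1 + ('X - 1) * true_poly_rev w.

Lemma size_false_poly w : (size (false_poly w) <= size w)%N.
Proof.
elim: w => [|b w IH] /=; first by rewrite size_poly0.
apply: leq_trans (size_polyD _ _) _; rewrite geq_max; apply/andP; split.
  by case: b; rewrite ?size_poly0 ?size_poly1.
by rewrite mulrC; apply: leq_trans (size_polyMleq _ _) _; rewrite size_polyX addn2.
Qed.

Lemma size_true_poly_rev w : (size (true_poly_rev w) <= size w)%N.
Proof.
elim: w => [|b w IH] /=; first by rewrite size_poly0.
apply: leq_trans (size_polyD _ _) _; rewrite geq_max; apply/andP; split.
  by case: b; rewrite ?mul1r ?mul0r ?size_polyXn ?size_poly0.
exact: leqW.
Qed.

Lemma count_mem_mapS h (s : seq nat) : count_mem h.+1 (map S s) = count_mem h s.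
Proof. by rewrite count_map; apply: eq_count. Qed.

Lemma count_mem0_mapS (s : seq nat) : count_mem 0%N (map S s) = 0%N.
Proof. by rewrite count_map (eq_count (a2 := pred0)) // count_pred0. Qed.

Lemma count0_gaps w : count_mem 0%N (gaps w) = 0%N.
Proof. by case: w => //= b w; rewrite count_cat count_mem0_mapS count_nseq. Qed.

Lemma coef_false_poly w h : (false_poly w)`_h = (count_mem h.+1 (gaps w))%:R.
Proof.
elim: w h => [|b w IH] h /=; first by rewrite coef0.
rewrite coefD coefXM count_cat count_nseq count_mem_mapS.
case: h => [|h]; first by case: b; rewrite ?coef0 ?coef1 count0_gaps.
by rewrite IH /= mul0n; case: b; rewrite /= ?coef0 ?coef1 add0r.
Qed.

(** A vertical step at position p and a horizontal one at q, counted from 0, give the exponent (size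
    w - 1 - p) + q. It is at least [size w] exactly when p < q, and the hook number is then q -
    p. *)
Lemma coef_hooks w h :
  (false_poly w * true_poly_rev w)`_(size w + h) = (count_mem h.+1 (hooks w))%:R.
Proof.
elim: w h => [|b w IH] h /=; first by rewrite mul0r coef0.
case: b => /=.
  rewrite add0r mul1r mulrDr coefD -!mulrA !coefXM /= coefMXn.
  rewrite addKn IH ltnNge leq_addr /= coef_false_poly.
  by rewrite count_cat natrD.
rewrite mul0r add0r mulrDl mul1r -mulrA coefD coefXM /= IH.
rewrite nth_default ?add0r //.
by apply: leq_trans (size_true_poly_rev w) _; rewrite leqW // leq_addr.
Qed.

Lemma count0_hooks w : count_mem 0%N (hooks w) = 0%N.
Proof. by elim: w => // -[|] w IH; rewrite /= ?count_cat IH ?count0_gaps. Qed.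

(* Write F and T for the two polynomials of w. Then corners w * corners_rev w is
   1 + (X - 1)(F + T) + (X - 1)^2 F T. After division by X - 1 the linear part
   has size at most [size w], so the products F T of w and v agree from the
   coefficient of index [size w] on, and these coefficients count the hooks. *)
Lemma perm_hooks_corners w v : size w = size v ->
  corners w * corners_rev w = corners v * corners_rev v ->
  perm_eq (hooks w) (hooks v).
Proof.
move=> sz e.
set E := false_poly w * true_poly_rev w - false_poly v * true_poly_rev v.
set L := false_poly w + true_poly_rev w - (false_poly v + true_poly_rev v).
have X1 : ('X - 1 : {poly int}) != 0 by rewrite -polyC1 polyXsubC_eq0.
have EL : ('X - 1) * E = - L.
  apply: (mulfI X1); rewrite /E /L; move: e; rewrite /corners /corners_rev.
  move=> /eqP; rewrite -subr_eq0 => /eqP e0.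
  by apply/eqP; rewrite -subr_eq0 -e0; apply/eqP; ring.
have sD x : (size (false_poly x + true_poly_rev x)%R <= size x)%N.
  by rewrite (leq_trans (size_polyD _ _)) // geq_max size_false_poly size_true_poly_rev.
have sL : (size L <= size w)%N.
  by rewrite /L (leq_trans (size_polyD _ _)) // size_polyN geq_max sD sz sD.
have sE : (size E <= size w)%N.
  have [->|E0] := eqVneq E 0; first by rewrite size_poly0.
  move: sL; rewrite -size_polyN -EL size_mul // -polyC1 size_XsubC.
  exact: ltnW.
apply/allP => h _ /=; apply/eqP.
case: h => [|h]; first by rewrite !count0_hooks.
have /eqP : (count_mem h.+1 (hooks w))%:R == (count_mem h.+1 (hooks v))%:R :> int.
  rewrite -!coef_hooks -subr_eq0 -sz -coefB -/E.
  by rewrite nth_default // (leq_trans sE) // leq_addr.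
by rewrite !natz => -[].
Qed.

Lemma corners_cat x y : corners (x ++ y) = corners x + 'X^(size x) * (corners y - 1).
Proof.
elim: x => [|b x IH] /=; first by rewrite /corners /=; ring.
rewrite exprS -mulrA; move: IH; rewrite /corners /= => IH.
transitivity (1 + ('X - 1) * (~~ b)%:R + 'X * (1 + ('X - 1) * false_poly (x ++ y) - 1)).
  by ring.
by rewrite IH; ring.
Qed.

Lemma corners_rev_cat x y :
  corners_rev (x ++ y) = corners_rev y + 'X^(size y) * (corners_rev x - 1).
Proof.
elim: x => [|b x IH] /=; first by rewrite /corners_rev /=; ring.
move: IH; rewrite /corners_rev /= size_cat exprD => IH.
transitivity (('X - 1) * (b%:R * ('X^(size x) * 'X^(size y)))
   + (1 + ('X - 1) * true_poly_rev (x ++ y))); first by ring.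
by rewrite IH; ring.
Qed.

(** The [false_poly] of [u] and of its complement add up to 1 + X + ... + X^(size u - 1). *)
Lemma corners_map_negb u : corners (map negb u) = 'X^(size u) + 1 - corners u.
Proof.
elim: u => [|b u IH] /=; first by rewrite /corners /=; ring.
rewrite exprS; move: IH; rewrite /corners /= => IH.
transitivity (1 + ('X - 1) * (~~ ~~ b)%:R
   + 'X * (1 + ('X - 1) * false_poly (map negb u) - 1)); first by ring.
by rewrite IH; case: b; rewrite /=; ring.
Qed.

Lemma corners_rev_map_negb u :
  corners_rev (map negb u) = 'X^(size u) + 1 - corners_rev u.
Proof.
elim: u => [|b u IH] /=; first by rewrite /corners_rev /=; ring.
rewrite exprS; move: IH; rewrite /corners_rev /= size_map => IH.
transitivity (('X - 1) * ((~~ b)%:R * 'X^(size u))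
   + (1 + ('X - 1) * true_poly_rev (map negb u))); first by ring.
by rewrite IH; case: b; rewrite /=; ring.
Qed.

Lemma corners_nseq_true n : corners (nseq n true) = 1.
Proof.
rewrite /corners; have -> : false_poly (nseq n true) = 0; last by ring.
by elim: n => //= n ->; ring.
Qed.

Lemma corners_rev_nseq_false n : corners_rev (nseq n false) = 1.
Proof.
rewrite /corners_rev; have -> : true_poly_rev (nseq n false) = 0; last by ring.
by elim: n => //= n ->; ring.
Qed.

Lemma corners_nseq_false n : corners (nseq n false) = 'X^n.
Proof.
have := corners_map_negb (nseq n true).
by rewrite map_nseq size_nseq corners_nseq_true => ->; ring.
Qed.

Lemma corners_rev_nseq_true n : corners_rev (nseq n true) = 'X^n.
Proof.
have := corners_rev_map_negb (nseq n false).
by rewrite map_nseq size_nseq corners_rev_nseq_false => ->; ring.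
Qed.

Definition cornersE := (corners_cat, corners_rev_cat, corners_map_negb,
  corners_rev_map_negb, corners_nseq_true, corners_nseq_false,
  corners_rev_nseq_true, corners_rev_nseq_false).

End CornerPolynomial.

(** * A family of words with equal hooks *)

(** With 1^D in place of [u], this word and the next bound, up to empty rows, two conjugate
    rectangles: D rows of length 2D, and 2D rows of length D. *)
Definition short_copy (u : seq bool) :=
  u ++ map negb u ++ nseq (size u) false ++ u.

Definition tall_copy (u : seq bool) :=
  u ++ nseq (size u) true ++ map negb u ++ u.

(** Starting from a horizontal step makes every word end in one, so that no row is empty. *)
Fixpoint family (m : nat) : seq (seq bool) :=
  if m is p.+1 then map short_copy (family p) ++ map tall_copy (family p)
  else [:: [:: false]].

Lemma size_family m : size (family m) = 2 ^ m.
Proof. by elim: m => //= m IH; rewrite size_cat !size_map IH addnn expnS mul2n. Qed.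

Lemma familyP m u : u \in family m.+1 ->
  exists2 v, v \in family m & u = short_copy v \/ u = tall_copy v.
Proof. by rewrite /= mem_cat => /orP[] /mapP[v vm ->]; exists v => //; [left | right]. Qed.

Lemma size_mem_family m u : u \in family m -> size u = 4 ^ m.
Proof.
elim: m u => [|m IH] u; first by rewrite inE => /eqP ->.
by move=> /familyP[v /IH sv] [] ->;
  rewrite !size_cat size_map size_nseq sv expnS; lia.
Qed.

Lemma last_mem_family m u : u \in family m -> exists v, u = rcons v false.
Proof.
elim: m u => [|m IH] u; first by rewrite inE => /eqP ->; exists [::].
by move=> /familyP[v /IH [y ->]] [] ->;
  rewrite /short_copy /tall_copy !catA -rcons_cat; eexists.
Qed.

Lemma family_uniq m : uniq (family m).
Proof.
elim: m => //= m IH.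
have inj (c : seq bool -> seq bool) :
    (forall u, take (size u) (c u) = u) -> {in family m &, injective c}.
  move=> cE u v um vm e.
  by rewrite -(cE u) -(cE v) e (size_mem_family um) (size_mem_family vm).
rewrite cat_uniq !map_inj_in_uniq ?IH ?andbT /=; last 2 first.
- by apply: inj => u; rewrite take_size_cat.
- by apply: inj => u; rewrite take_size_cat.
apply/hasPn => _ /mapP[u um ->]; apply/mapP => -[v vm].
have suv : size u = size v by rewrite (size_mem_family um) (size_mem_family vm).
have u0 : 0 < size u by rewrite (size_mem_family um) expn_gt0.
(* Comparing block by block, the complement of the common first block would be both all true and all
   false. *)
rewrite /short_copy /tall_copy -suv => /eqP; rewrite eqseq_cat // => /andP[/eqP uv].
rewrite eqseq_cat ?size_map ?size_nseq // => /andP[/eqP e1].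
rewrite eqseq_cat ?size_map ?size_nseq // => /andP[/eqP e2 _].
by move: e1; rewrite -uv e2; case: (size u) u0.
Qed.

(** Either copy puts one of the two mirror factors into [corners] and the other into [corners_rev],
    so the product does not see the choice. *)
Lemma corners_family m u v : u \in family m -> v \in family m ->
  (corners u * corners_rev u = corners v * corners_rev v)%R.
Proof.
elim: m u v => [|m IH] u v; first by rewrite !inE => /eqP -> /eqP ->.
pose t := ('X ^+ (4 ^ m) : {poly int})%R.
have copy x : x \in family m.+1 -> exists2 y, y \in family m &
  (corners x * corners_rev x = corners y * corners_rev y *
     ((1 - t + t ^+ 3) * (1 - t ^+ 2 + t ^+ 3)))%R.
  move=> /familyP[y ym xy]; exists y => //.
  have sy := size_mem_family ym.
  by case: xy => ->; rewrite /short_copy /tall_copy !cornersE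
    !size_cat !size_map !size_nseq sy !exprD -/t; ring.
by move=> /copy[x xm ->] /copy[y ym ->]; rewrite (IH x y).
Qed.

(** Either copy adds 2 D^2 boxes with D = 4^m, the common area of the two rectangles. *)
Lemma sumn_rows_family m u v : u \in family m -> v \in family m ->
  sumn (rows u) = sumn (rows v).
Proof.
elim: m u v => [|m IH] u v; first by rewrite !inE => /eqP -> /eqP ->.
have copy x : x \in family m.+1 -> exists2 y, y \in family m &
  sumn (rows x) = sumn (rows y) + 2 * (4 ^ m * 4 ^ m).
  move=> /familyP[y ym xy]; exists y => //.
  have sy := size_mem_family ym.
  have := count_id_negb y; rewrite sy => D; have := sumn_rows_map_negb y.
  by case: xy => ->; rewrite /short_copy /tall_copy !sumn_rows_cat !sumn_rows_nseq
    !count_cat !count_id_map_negb !count_negb_map_negb !count_nseq sy /= -D; lia.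
by move=> /copy[x xm ->] /copy[y ym ->]; rewrite (IH x y).
Qed.

(** * Spread words and their sizes *)

(** The cut before 1^b keeps the head independent of [b] and makes all [gaps] of the tail exceed
    [b]. *)
Definition spread_head (u : seq bool) (e : nat) :=
  u ++ nseq e true ++ map negb u ++ false :: u.

Definition spread_tail (u : seq bool) (b : nat) :=
  nseq b true ++ map negb u ++ u.

(* The corner polynomial of the spread word is that of u times that of
   1^(e+D) 0^(D+1) 1^(b+D) 0^D, where D is the length of u. *)
Definition spread (u : seq bool) (e b : nat) := spread_head u e ++ spread_tail u b.

Lemma size_spread u e b : size (spread u e b) = 5 * size u + e + b + 1.
Proof.
by rewrite /spread /spread_head /spread_tail !size_cat /= !size_nseq !size_map; lia.
Qed.

Lemma corners_spread u e b (t := ('X ^+ size u : {poly int})%R)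
    (s := ('X ^+ e : {poly int})%R) (r := ('X ^+ b : {poly int})%R) :
  (corners (spread u e b) =
    corners u * (1 - t * s + t ^+ 2 * s * 'X - t ^+ 3 * s * 'X * r
                 + t ^+ 4 * s * 'X * r))%R.
Proof.
rewrite /spread /spread_head /spread_tail -[false :: u]/(nseq 1 false ++ u).
rewrite -!catA !cornersE !size_map !size_nseq expr1 -/t -/s -/r; ring.
Qed.

Lemma corners_rev_spread u e b (t := ('X ^+ size u : {poly int})%R)
    (s := ('X ^+ e : {poly int})%R) (r := ('X ^+ b : {poly int})%R) :
  (corners_rev (spread u e b) =
    corners_rev u * (1 - t + t ^+ 2 * r - t ^+ 3 * r * 'X
                     + t ^+ 4 * r * 'X * s))%R.
Proof.
rewrite /spread /spread_head /spread_tail -[false :: u]/(nseq 1 false ++ u).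
rewrite -!catA !cornersE !size_cat !size_map !size_nseq !exprD expr1 -/t -/s -/r; ring.
Qed.

(** Each step of 1^e precedes 2D + 1 horizontal steps. The extra [false] in the head makes this 1
    modulo D, so the residue of [e] controls that of the size. *)
Lemma sumn_rows_spread u e b (D := size u) :
  sumn (rows (spread u e b)) =
  sumn (rows u) + D * (b + D) + (2 * D + 1) * (e + D).
Proof.
rewrite /D -(count_id_negb u); have := sumn_rows_map_negb u.
rewrite /spread /spread_head /spread_tail -[false :: u]/(nseq 1 false ++ u).
rewrite !sumn_rows_cat !sumn_rows_nseq !count_cat !count_id_map_negb.
rewrite !count_negb_map_negb !count_nseq /=; lia.
Qed.

Lemma perm_hooks_spread m u v e b : u \in family m -> v \in family m ->
  perm_eq (hooks (spread u e b)) (hooks (spread v e b)).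
Proof.
move=> um vm; have suv : size u = size v.
  by rewrite (size_mem_family um) (size_mem_family vm).
apply: perm_hooks_corners; first by rewrite !size_spread suv.
rewrite !corners_spread !corners_rev_spread suv.
by rewrite mulrACA (corners_family um vm) mulrACA.
Qed.

(** * Comparison of hook products *)

Definition hook_prod (w : seq bool) := \prod_(h <- hooks w) h.

Lemma hook_prod_true w : hook_prod (true :: w) = (\prod_(h <- gaps w) h) * hook_prod w.
Proof. by rewrite /hook_prod /= big_cat. Qed.

Lemma hook_prod_gt0 w : 0 < hook_prod w.
Proof.
rewrite /hook_prod big_seq prodn_cond_gt0 // => h hw.
by rewrite lt0n; apply: contraTneq hw => ->; rewrite -has_pred1 has_count count0_hooks.
Qed.

Lemma gaps_cat x y : gaps (x ++ y) = gaps x ++ map (addn (size x)) (gaps y).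
Proof.
elim: x => [|b x IH] /=; first by rewrite -[LHS]map_id; apply: eq_map.
by rewrite IH map_cat catA -!map_comp.
Qed.

Lemma gaps_le w : all (leq^~ (size w)) (gaps w).
Proof.
elim: w => //= b w IH; rewrite all_cat all_map; apply/andP; split.
  by case: b.
exact: IH.
Qed.

Lemma prod_ge_expn c (s : seq nat) : all (leq c) s -> c ^ size s <= \prod_(h <- s) h.
Proof.
elim: s => [|h s IH] /=; first by rewrite big_nil.
by move=> /andP[ch /IH le]; rewrite big_cons expnS leq_mul.
Qed.

Lemma prod_le_expn c (s : seq nat) : all (leq^~ c) s -> \prod_(h <- s) h <= c ^ size s.
Proof.
elim: s => [|h s IH] /=; first by rewrite big_nil.
by move=> /andP[ch /IH le]; rewrite big_cons expnS leq_mul.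
Qed.

Lemma prod_gaps_gt0 w : 0 < \prod_(h <- gaps w) h.
Proof. by have := hook_prod_gt0 (true :: w); rewrite hook_prod_true muln_gt0 => /andP[]. Qed.

Lemma hook_prod_cat_ge c x w : all (leq c) (gaps w) ->
  c ^ (count id x * count negb w) * hook_prod w <= hook_prod (x ++ w).
Proof.
move=> cw; elim: x => [|[|] x IH]; rewrite ?cat_cons //=.
  by rewrite mul1n.
rewrite hook_prod_true mulnDl mul1n expnD -mulnA leq_mul // gaps_cat big_cat /=.
apply: leq_trans (leq_pmull _ (prod_gaps_gt0 _)).
rewrite -size_gaps -(size_map (addn (size x))) prod_ge_expn // all_map.
by apply: sub_all cw => h /= ch; apply: leq_trans (leq_addl _ _).
Qed.

Lemma leq_expl k m n : m <= n -> m ^ k <= n ^ k.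
Proof. by case: k => // k mn; rewrite leq_exp2r. Qed.

Lemma hook_prod_cat_le x w :
  hook_prod (x ++ w) <=
  hook_prod x * hook_prod w * (size x + size w) ^ (count id x * count negb w).
Proof.
elim: x => [|b x IH]; first by rewrite /= muln1 [hook_prod [::]]big_nil mul1n.
have le_step k : (size x + size w) ^ k <= (size (b :: x) + size w) ^ k.
  by rewrite leq_expl //= addSn.
case: b le_step => le_step; last first.
  by apply: leq_trans IH _; rewrite leq_mul2l le_step orbT.
rewrite cat_cons !hook_prod_true gaps_cat big_cat /= mulnDl mul1n expnD.
have le_w : \prod_(h <- map (addn (size x)) (gaps w)) h <=
    (size (true :: x) + size w) ^ count negb w.
  rewrite -size_gaps -(size_map (addn (size x))).
  rewrite (leq_trans (prod_le_expn (c := size x + size w) _)) ?le_step // all_map.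
  by apply: sub_all (gaps_le w) => h /=; rewrite leq_add2l.
have {IH}IH := leq_trans IH (leq_mul (leqnn _) (le_step _)).
apply: leq_trans (leq_mul (leq_mul (leqnn _) le_w) IH) _.
by rewrite /=; apply: eq_leq; ring.
Qed.

(** Every vertical step of the prefix forms hooks with the z horizontal steps of [w]. These hooks
    are at least b + 1 after [x] and at most c (b + 1) after [y]. The additional vertical step of
    [x] thus gains a factor b + 1, which outweighs the constant bounded by [b]. *)
Lemma hook_prod_lt x y w b c :
  all (leq b.+1) (gaps w) -> 0 < count negb w -> count id y < count id x ->
  size y + size w <= c * b.+1 ->
  hook_prod y * c ^ (count id y * count negb w) <= b ->
  hook_prod (y ++ w) < hook_prod (x ++ w).
Proof.
move=> gw w0 yx szc thr.
set z := count negb w in w0 thr *; set p := count id y in yx thr *.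
apply: leq_trans (hook_prod_cat_ge x gw); rewrite -/z.
apply: leq_ltn_trans (hook_prod_cat_le y w) _; rewrite -/z -/p.
apply: (@leq_ltn_trans (hook_prod y * hook_prod w * (c * b.+1) ^ (p * z))).
  by rewrite leq_mul2l leq_expl // orbT.
rewrite expnMn.
apply: (@leq_trans (b.+1 ^ (p * z).+1 * hook_prod w)).
  rewrite (_ : hook_prod y * hook_prod w * _ =
    (hook_prod y * c ^ (p * z)) * (b.+1 ^ (p * z) * hook_prod w)); last by ring.
  by rewrite expnS -[X in _ < X]mulnA ltn_pmul2r ?muln_gt0 ?expn_gt0 ?hook_prod_gt0.
rewrite leq_pmul2r ?hook_prod_gt0 // leq_pexp2l //.
apply: (@leq_trans (p.+1 * z)); first by rewrite mulSn -add1n leq_add2r.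
by rewrite leq_mul2r yx orbT.
Qed.

Lemma count_id_spread_head u e : count id (spread_head u e) = size u + e + count id u.
Proof.
by rewrite /spread_head !count_cat /= count_id_map_negb count_nseq -(count_id_negb u) /=; lia.
Qed.

Lemma size_spread_head u e : size (spread_head u e) = 3 * size u + e + 1.
Proof.
by rewrite /spread_head !size_cat /= size_map size_nseq; lia.
Qed.

Lemma hook_prod_spread_lt u e e' b d :
  0 < size u -> e' < e + d ->
  hook_prod (spread_head u e') *
    (5 * size u + e' + 1) ^ (count id (spread_head u e') * size u) <= b ->
  hook_prod (spread u e' b) < hook_prod (spread u e (d + b)).
Proof.
move=> u0 lt thr.
have z : count negb (spread_tail u b) = size u.
  rewrite /spread_tail !count_cat count_nseq count_negb_map_negb -(count_id_negb u).
  by rewrite /= mul0n.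
(* The surplus 1^d is moved into the head, so that both words have the same tail. *)
have -> : spread u e (d + b) = (spread_head u e ++ nseq d true) ++ spread_tail u b.
  by rewrite /spread /spread_tail nseqD -!catA.
(* The word [spread u e' b] has length c + b for this c, hence at most c (b + 1). *)
apply: (@hook_prod_lt _ _ _ b (5 * size u + e' + 1)); rewrite ?z //.
- rewrite /spread_tail gaps_cat size_nseq all_cat all_map.
  have -> : gaps (nseq b true) = [::] by elim: (b) => //= n ->.
  rewrite /=; apply/allP => h /= hw; rewrite -addn1 leq_add2l lt0n.
  by apply: contraTneq hw => ->; rewrite -has_pred1 has_count count0_gaps.
- by rewrite count_cat !count_id_spread_head count_nseq; lia.
- rewrite size_spread_head /spread_tail !size_cat size_nseq size_map mulnS.
  have : b <= (5 * size u + e' + 1) * b by rewrite leq_pmull // addn1.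
  lia.
Qed.

(** * Passage to partitions and choice of parameters *)

Lemma hook_multiset_rows w : hook_multiset (rows w) = seq_mset (hooks w).
Proof. exact/eq_seq_msetP/perm_hooks. Qed.

Lemma hook_product_rows w : hook_product (rows w) = hook_prod w.
Proof.
rewrite /hook_product /hook_prod -(big_map (hook (rows w)) predT id).
exact/perm_big/perm_hooks.
Qed.

Lemma hook_prod_perm w v : perm_eq (hooks w) (hooks v) -> hook_prod w = hook_prod v.
Proof. exact: perm_big. Qed.

Lemma is_partition_spread m u e b : u \in family m ->
  is_partition (sumn (rows (spread u e b))) (rows (spread u e b)).
Proof.
move=> um; rewrite /is_partition rows_sorted eqxx andbT /=.
have [v ->] := last_mem_family um.
by rewrite /spread /spread_head /spread_tail !catA -rcons_cat rows_gt0.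
Qed.

Lemma rows_spread_inj m e b : {in family m &, injective (fun u => rows (spread u e b))}.
Proof.
move=> u v um vm e'.
have suv : size u = size v by rewrite (size_mem_family um) (size_mem_family vm).
have : spread u e b = spread v e b by apply: rows_inj; rewrite ?size_spread ?suv.
move=> /(congr1 (take (size u))).
by rewrite {1}/spread suv /spread /spread_head -!catA !take_size_cat.
Qed.

Theorem theorem1p4 (k l : nat) (k_gt0 : 0 < k) (l_gt0 : 0 < l) :
  exists N : nat, forall n : nat, N <= n ->
  exists A : 'I_k -> {fset seq nat},
    (forall i : 'I_k, #|` A i| = l) /\
    (forall (i : 'I_k) (la : seq nat), la \in A i -> is_partition n la) /\
    (forall i j : 'I_k, i != j -> [disjoint A i & A j]%fset) /\
    (forall (i : 'I_k) (la mu : seq nat), la \in A i -> mu \in A i ->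
       hook_multiset la = hook_multiset mu) /\
    (forall (i j : 'I_k) (la mu : seq nat), i != j -> la \in A i -> mu \in A j ->
       hook_multiset la <> hook_multiset mu /\
       hook_product la <> hook_product mu).
Proof.
pose D := 4 ^ l; have D0 : 0 < D by rewrite expn_gt0.
have [u0 u0F] : exists u, u \in family l.
  have : 0 < size (family l) by rewrite size_family expn_gt0.
  by case: (family l) => // u s _; exists u; rewrite mem_head.
have su u : u \in family l -> size u = D by apply: size_mem_family.
(* This is the size of the partition with e = b = 0. *)
pose S := sumn (rows u0) + D * D + (2 * D + 1) * D.
pose thr e := hook_prod (spread_head u0 e) *
    (5 * size u0 + e + 1) ^ (count id (spread_head u0 e) * size u0).
(* All values r + D i with r < D and i < k lie below D (k + 1), so [T] bounds their thresholds
   independently of [n]. *)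
pose T := \max_(e < D * k.+1) thr e.
exists (S + D * (T + 2 * D + (2 * D + 1) * k)) => n nN.
pose q := (n - S) %/ D; pose r := (n - S) %% D.
have rD : r < D by rewrite ltn_mod.
have nE : n = q * D + r + S by rewrite -divn_eq subnK //; lia.
have qT : T + 2 * D + (2 * D + 1) * k <= q by rewrite leq_divRL // mulnC; lia.
(* These [e] and [b] solve D b + (2D + 1) e = q D + r; the lower bound on [q] keeps every [b i] at
   least [T]. *)
pose e (i : nat) := r + D * i.
pose b (i : nat) := q - 2 * r - (2 * D + 1) * i.
pose w (i : nat) u := spread u (e i) (b i).
have bE i : i < k -> b i + 2 * r + (2 * D + 1) * i = q /\ T <= b i.
  move=> ik; have : (2 * D + 1) * i <= (2 * D + 1) * k by rewrite leq_mul2l ltnW ?orbT.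
  by rewrite /b; lia.
have wn i u : i < k -> u \in family l -> sumn (rows (w i u)) = n.
  move=> ik uF; rewrite sumn_rows_spread (su _ uF) (sumn_rows_family uF u0F).
  by have [qE _] := bE i ik; rewrite nE -qE /S /e; lia.
have prod_lt i j : i < j -> j < k -> hook_prod (w j u0) < hook_prod (w i u0).
  move=> ij jk; have [bj Tj] := bE j jk; have [bi _] := bE i (ltn_trans ij jk).
  pose g := j - i; have jE : j = i + g by rewrite subnKC // ltnW.
  have g0 : 0 < g by rewrite subn_gt0.
  (* From j down to i, [e] loses only D g while [b] gains (2D + 1) g, so the number of vertical
     steps grows. *)
  have bij : b i = (2 * D + 1) * g + b j.
    by move: bi; rewrite -bj jE mulnDr; lia.
  rewrite /w bij; apply: hook_prod_spread_lt; rewrite ?su //.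
    by rewrite /e jE mulnDr mulnDl; lia.
  apply: leq_trans Tj; rewrite -(su _ u0F) -/(thr (e j)).
  have ej : e j < D * k.+1.
    by rewrite mulnS /e -addSn leq_add // leq_mul2l ltnW ?orbT.
  exact: (@leq_bigmax _ (fun e : 'I_(D * k.+1) => thr e) (Ordinal ej)).
have prod_neq (i j : 'I_k) : i != j -> hook_prod (w i u0) <> hook_prod (w j u0).
  rewrite -val_eqE neq_ltn => /orP[] lt eq.
    by have := prod_lt _ _ lt (ltn_ord j); rewrite eq ltnn.
  by have := prod_lt _ _ lt (ltn_ord i); rewrite eq ltnn.
(* There are enough words, since l < 2^l. *)
pose us := take l (family l).
have usF u : u \in us -> u \in family l by apply: mem_take.
pose A (i : 'I_k) := [fset rows (w i u) | u in us]%fset.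
have AP i la : la \in A i -> exists2 u, u \in family l & la = rows (w i u).
  by move=> /imfsetP[u /= /usF uF ->]; exists u.
have prod_A i la : la \in A i -> hook_product la = hook_prod (w i u0).
  move=> /AP[u uF ->]; rewrite hook_product_rows.
  exact/hook_prod_perm/(perm_hooks_spread _ _ uF u0F).
have prod_AA (i j : 'I_k) la mu : i != j -> la \in A i -> mu \in A j ->
    hook_product la <> hook_product mu.
  by move=> ij /prod_A -> /prod_A ->; apply: prod_neq.
have mset_prod w1 w2 : hook_multiset (rows w1) = hook_multiset (rows w2) ->
    hook_product (rows w1) = hook_product (rows w2).
  rewrite !hook_multiset_rows !hook_product_rows => /eq_seq_msetP.
  exact: hook_prod_perm.
exists A; split; [|split; [|split; [|split]]].
- move=> i; rewrite card_in_imfset /=; last first.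
    by move=> u v uI vI; apply: (rows_spread_inj (m := l)); apply: usF.
  rewrite undup_id ?take_uniq ?family_uniq // size_takel // size_family.
  exact/ltnW/ltn_expl.
- move=> i la /AP[u uF ->]; rewrite -(wn i u (ltn_ord i) uF).
  exact: is_partition_spread uF.
- move=> i j ij; apply/fdisjointP => la lai; apply/negP => laj.
  exact: prod_AA ij lai laj erefl.
- move=> i la mu /AP[u uF ->] /AP[v vF ->]; rewrite !hook_multiset_rows.
  exact/eq_seq_msetP/(perm_hooks_spread _ _ uF vF).
- move=> i j la mu ij lai muj; have neq := prod_AA _ _ _ _ ij lai muj; split=> //.
  case/AP: lai neq => u _ ->; case/AP: muj => v _ -> neq eq.
  exact/neq/mset_prod.
Qed.
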